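(* Let $n,B,k\in\mathbb{N}$ with $k\ge 2$ and $B\le n/k$, and let $f_j=1/j$ for $j\in[n]$. Let $h_1,\dots,h_k:[n]\to[B]$ be independent, truly (uniformly) random hash functions. For $i\in[n]$ define the random variable $$\tilde f_i=\min_{\ell\in[k]}\Big(\sum_{j\in[n]}[h_\ell(j)=h_\ell(i)]\,f_j\Big).$$ Then for every $i\in[n]$, $$\mathbb{E}\big[|\tilde f_i-f_i|\big]=\Theta\!\left(\frac{\log(n/B)}{B}\right),$$ where the implied constants are absolute (independent of $n,B,k,i$).
   Context: $[n]=\{1,\dots,n\}$. For an event $E$, $[E]\in\{0,1\}$ denotes its indicator. This $\tilde f_i$ is the Count-Min estimate of the frequency of item $i$ when the item frequencies follow the Zipfian law $f_j=1/j$. *)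

(* Defs.v *)
From mathcomp Require Export all_boot all_order all_algebra.
From mathcomp Require Export all_classical all_reals all_analysis.

Set Implicit Arguments.
Unset Strict Implicit.
Unset Printing Implicit Defensive.

Import Order.TTheory GRing.Theory Num.Theory.

Local Open Scope classical_set_scope.
Local Open Scope ring_scope.

(* [n] = {1, ..., n} is represented by 'I_n: the ordinal j : 'I_n stands for
   the item j.+1. *)
Definition hashfun (n B : nat) := {ffun 'I_n -> 'I_B}.

Definition zipf (R : realType) (n : nat) (j : 'I_n) : R := (j.+1)%:R^-1.

Definition bucket (R : realType) (n B : nat) (g : hashfun n B) (i : 'I_n) : R :=
  \sum_(j < n) (g j == g i)%:R * zipf R j.

(* The neutral element of the iterated minimum is the total mass, which bounds
   every bucket from above; for k > 0 it therefore does not affect the value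
   (see count_min_le and count_min_attained). *)
Definition count_min (R : realType) (n B k : nat) (g : 'I_k -> hashfun n B)
    (i : 'I_n) : R :=
  \big[Num.min / \sum_(j < n) zipf R j]_(l < k) bucket R (g l) i.

Section random_elements.
Context (d : measure_display) (T : measurableType d) (R : realType).
Variable P : probability T R.

(* The finite type U carries the discrete sigma-algebra. *)
Definition finite_random_element (U : finType) (X : T -> U) : Prop :=
  forall A : set U, measurable (X @^-1` A).

Definition uniform_element (U : finType) (X : T -> U) : Prop :=
  forall u : U, P (X @^-1` [set u]) = (#|U|%:R^-1)%:E.

(* Since A i = setT is allowed, this covers all subfamilies. *)
Definition mutually_independent (I U : finType) (X : I -> T -> U) : Prop :=
  forall A : I -> set U,
    P (\bigcap_i (X i @^-1` A i)) = (\prod_(i : I) P (X i @^-1` A i))%E.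

End random_elements.

Lemma count_min_le (R : realType) (n B k : nat) (g : 'I_k -> hashfun n B)
    (i : 'I_n) (l : 'I_k) : count_min R g i <= bucket R (g l) i.
Proof. by rewrite /count_min (bigD1 l) //= ge_min lexx. Qed.

Lemma count_min_attained (R : realType) (n B k : nat)
    (g : 'I_k -> hashfun n B) (i : 'I_n) :
  (0 < k)%N -> exists l : 'I_k, count_min R g i = bucket R (g l) i.
Proof.
move=> k0; pose m := [arg min_(l < Ordinal k0) bucket R (g l) i]%O.
have mP l : bucket R (g m) i <= bucket R (g l) i.
  by rewrite /m; case: arg_minP => // l0 _; exact.
exists m; apply/eqP; rewrite eq_le count_min_le /= /count_min.
elim/big_ind: _ => [|x y xm ym|l _]; last exact: mP.
- apply: ler_sum => j _; rewrite ler_piMl ?invr_ge0 ?ler0n //.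
  by case: eqP.
- by rewrite le_min xm ym.
Qed.

(* Main.v *)
Require Import Defs.
From mathcomp Require Import all_boot all_order all_algebra.
From mathcomp Require Import all_classical all_reals all_analysis.
From mathcomp Require Import measurable_realfun ring lra.

(** Let [s_l] be the error of the [l]-th hash function, i.e. the mass of the
    items other than [i] that share the bucket of [i], and let [x = n / B >= k].

    Lower bound.  Conditionally on the bucket of [i] the other items fall into it
    independently with probability [1 / B], so
    [E exp (-8 B s_l) = \prod_(j <> i) (1 - (1 - exp (-8 B / j)) / B)].  From
    [exp (-y) <= 1 / (1 + y)] and Bernoulli's inequality, the [j]-th factor is at
    most [((a - 1) / a) ^ 8] with [a = j + 8 B], and the product telescopes to at
    most [(9 / (x + 8)) ^ 8].  By Chernoff's inequality at [t = ln x / 64] and a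
    union bound over the [k <= x] hash functions, all the [B s_l] are at least
    [t] with probability at least [1 / 100].

    Upper bound.  Two hash functions suffice.  Split [s_l] into the mass of the
    heavy items [j <= B], which is at most [W_l ^ 2] with
    [W_l = \sum_(j <= B) [h_l j = h_l i] / sqrt j], and the mass [C_l] of the
    light ones.  The minimum of [s_1] and [s_2] is at most
    [W_1 W_2 + C_1 + C_2]; by independence [E (W_1 W_2) <= (2 / sqrt B) ^ 2], and
    [E C_l <= ln x / B]. *)

Set Implicit Arguments.
Unset Strict Implicit.
Unset Printing Implicit Defensive.

Import Order.TTheory GRing.Theory Num.Theory.

Local Open Scope classical_set_scope.
Local Open Scope ring_scope.

(** * Averages over finite sets and over function spaces *)

Definition avg {R : realType} {U : finType} (phi : U -> R) : R :=
  #|U|%:R^-1 * \sum_u phi u.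

Section average.
Context {R : realType}.

Lemma avgD (U : finType) (f g : U -> R) :
  avg (fun u => f u + g u) = avg f + avg g.
Proof. by rewrite /avg big_split mulrDr. Qed.

Lemma avgZ (U : finType) (a : R) (f : U -> R) :
  avg (fun u => a * f u) = a * avg f.
Proof. by rewrite /avg -mulr_sumr mulrCA. Qed.

Lemma avg_sum (U I : finType) (P : pred I) (f : I -> U -> R) :
  avg (fun u => \sum_(i | P i) f i u) = \sum_(i | P i) avg (f i).
Proof. by rewrite /avg exchange_big -mulr_sumr. Qed.

Lemma le_avg (U : finType) (f g : U -> R) :
  (forall u, f u <= g u) -> avg f <= avg g.
Proof.
by move=> fg; rewrite ler_wpM2l ?invr_ge0 ?ler0n // ler_sum.
Qed.

Lemma avg_ge0 (U : finType) (f : U -> R) : (forall u, 0 <= f u) -> 0 <= avg f.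
Proof.
by move=> f0; rewrite mulr_ge0 ?invr_ge0 ?ler0n // sumr_ge0.
Qed.

Lemma eq_avg (U : finType) (f g : U -> R) : f =1 g -> avg f = avg g.
Proof. by move=> fg; congr (_ * _); apply: eq_bigr => u _; exact: fg. Qed.

Lemma avg_cst (U : finType) (a : R) : 
  (0 < #|U|)%N -> avg (fun _ : U => a) = a.
Proof.
move=> U0; rewrite /avg sumr_const -[a *+ _]mulr_natl mulrA mulVf ?mul1r //.
by rewrite pnatr_eq0 -lt0n.
Qed.

Lemma avg_pred1 (U : finType) (v : U) :
  avg (fun u => (u == v)%:R : R) = #|U|%:R^-1.
Proof.
rewrite /avg (bigD1 v) //= eqxx big1 ?addr0 ?mulr1 // => u /negPf.
by move=> ->.
Qed.

(** Independence of the coordinates: a product of sums expands into a sum over all functions. *)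
Lemma avg_prod (I U : finType) (F : I -> U -> R) :
  avg (fun f : {ffun I -> U} => \prod_i F i (f i)) = \prod_i avg (F i).
Proof.
rewrite /avg -bigA_distr_bigA big_split /= prodr_const card_ffun natrX.
by rewrite exprVn.
Qed.

Lemma avg_coord2 (I U : finType) (i j : I) (f g : U -> R) :
  (0 < #|U|)%N -> i != j ->
  avg (fun w : {ffun I -> U} => f (w i) * g (w j)) = avg f * avg g.
Proof.
move=> U0 ij.
(* Padding with the constant [1], whose average is [1], reduces the claim to [avg_prod]. *)
pose F l := if l == i then f else if l == j then g else fun=> 1.
have Fij (G : I -> (U -> R) -> R) : (forall l, G l (fun=> 1) = 1) ->
    \prod_l G l (F l) = G i f * G j g.
  move=> G1; rewrite (bigD1 i) //= (bigD1 j) 1?eq_sym //= big1 ?mulr1.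
    by rewrite /F eqxx [j == i]eq_sym (negPf ij) eqxx.
  by move=> l /andP[/negPf li /negPf lj]; rewrite /F li lj G1.
transitivity (avg (fun w : {ffun I -> U} => \prod_l F l (w l))).
  by apply: eq_avg => w; rewrite (Fij (fun l h => h (w l))).
by rewrite avg_prod (Fij (fun=> avg)) // => l; rewrite avg_cst.
Qed.

Lemma avg_coord (I U : finType) (i : I) (f : U -> R) :
  (0 < #|U|)%N ->
  avg (fun w : {ffun I -> U} => f (w i)) = avg f.
Proof.
move=> U0; pose F l := if l == i then f else fun=> 1.
have Fi (G : I -> (U -> R) -> R) : (forall l, G l (fun=> 1) = 1) ->
    \prod_l G l (F l) = G i f.
  move=> G1; rewrite (bigD1 i) //= big1 ?mulr1 /F ?eqxx // => l /negPf li.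
  by rewrite li G1.
transitivity (avg (fun w : {ffun I -> U} => \prod_l F l (w l))).
  by apply: eq_avg => w; rewrite (Fi (fun l h => h (w l))).
by rewrite avg_prod (Fi (fun=> avg)) // => l; rewrite avg_cst.
Qed.

(* Conditionally on [w i = v], the coordinates [w j] with [j != i] are still
   independent and uniform, and the resulting product does not depend on [v]. *)
Lemma avg_collisions (I U : finType) (i : I) (F : I -> bool -> R) :
  (0 < #|U|)%N ->
  avg (fun w : {ffun I -> U} => \prod_(j | j != i) F j (w j == w i)) =
  \prod_(j | j != i) (F j false + #|U|%:R^-1 * (F j true - F j false)).
Proof.
move=> U0.
(* The condition [w i = v] becomes the factor at [i], so each [v] gives a full product over the
   coordinates; for a given [w] only [v = w i] can contribute. *)
pose G v j (u : U) : R := if j == i then (u == v)%:R else F j (u == v).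
transitivity (avg (fun w : {ffun I -> U} => \sum_v \prod_j G v j (w j))).
  apply: eq_avg => w; rewrite (bigD1 (w i)) //=.
  rewrite [X in _ + X]big1 ?addr0 => [|v /negPf vi].
    rewrite [RHS](bigD1 i) //= /G !eqxx mul1r.
    by apply: eq_bigr => j /negPf ->.
  by rewrite (bigD1 i) //= /G eqxx [w i == v]eq_sym vi mul0r.
have Gj v j : j != i ->
    avg (G v j) = F j false + #|U|%:R^-1 * (F j true - F j false).
  move=> /negPf ji; rewrite /G ji -(avg_pred1 v) mulrC -avgZ.
  rewrite -[X in X + _](@avg_cst U (F j false)) // -avgD; apply: eq_avg => u.
  by case: (u == v); rewrite ?mulr1 ?mulr0 ?addr0 // addrC subrK.
rewrite avg_sum (eq_bigr (fun=> #|U|%:R^-1 * \prod_(j | j != i)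
    (F j false + #|U|%:R^-1 * (F j true - F j false)))) => [|v _]; last first.
  rewrite avg_prod (bigD1 i) //= {1}/G eqxx avg_pred1; congr (_ * _).
  by apply: eq_bigr => j; exact: Gj.
rewrite sumr_const -[_ *+ _]mulr_natl mulrA mulfV ?mul1r //.
by rewrite pnatr_eq0 -lt0n.
Qed.

Lemma avg_collision (I U : finType) (i j : I) :
  (0 < #|U|)%N -> j != i ->
  avg (fun w : {ffun I -> U} => (w j == w i)%:R : R) = #|U|%:R^-1.
Proof.
move=> U0 ji; pose F l (b : bool) : R := if l == j then b%:R else 1.
have := @avg_collisions I U i F U0.
rewrite [RHS](bigD1 j) //= [in RHS]big1 => [|l /andP[_ /negPf lj]]; last first.
  by rewrite /F lj subrr mulr0 addr0.
rewrite /F eqxx /= add0r subr0 !mulr1 => <-.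
apply: eq_avg => w; rewrite (bigD1 j) //= eqxx big1 ?mulr1 //.
by move=> l /andP[_ /negPf ->].
Qed.

End average.

(** * From random elements to finite averages *)

Section uniform_expectation.
Context {d : measure_display} {T : measurableType d} {R : realType}.
Variable P : probability T R.

Lemma expectation_uniform (U : finType) (X : T -> U) (phi : U -> R) :
  finite_random_element X -> uniform_element P X -> (forall u, 0 <= phi u) ->
  'E_P[fun t => phi (X t)]%E = (avg phi)%:E.
Proof.
move=> mX uX phi0; rewrite unlock.
transitivity (\int[P]_t (\sum_u ((phi u)%:E * (\1_(X @^-1` [set u]) t)%:E)))%E.
  apply: eq_integral => t _.
  rewrite (bigD1 (X t)) //= big1 => [|u uXt].
    by rewrite adde0 indicE mem_set // mule1.
  by rewrite indicE memNset ?mule0 // => /= Xtu; rewrite -Xtu eqxx in uXt.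
rewrite ge0_integral_sum //=; last first.
- by move=> u t _; rewrite -EFinM lee_fin mulr_ge0.
- by move=> u; apply/measurable_EFinP; exact: measurable_funM.
rewrite /avg mulr_sumr -sumEFin; apply: eq_bigr => u _.
rewrite ge0_integralZl ?lee_fin //; last first.
  by apply/measurable_EFinP; exact: measurable_indic.
by rewrite integral_indic // setIT mulrC EFinM -(uX u).
Qed.

(** Prescribing all the values is an intersection of marginal events, so independence makes every
    tuple equally likely. Functions of the whole family then fall under [expectation_uniform]. *)
Lemma uniform_joint (I U : finType) (X : I -> T -> U) :
  (forall i, finite_random_element (X i)) ->
  (forall i, uniform_element P (X i)) -> mutually_independent P X ->
  finite_random_element (fun t => [ffun i => X i t] : {ffun I -> U}) /\
  uniform_element P (fun t => [ffun i => X i t] : {ffun I -> U}).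
Proof.
move=> mX uX iX; pose Y t : {ffun I -> U} := [ffun i => X i t].
have Y1 f : Y @^-1` [set f] = \bigcap_i (X i @^-1` [set f i]).
  apply/seteqP; split=> [t <- i _|t tf] /=; first by rewrite ffunE.
  by apply/ffunP => i; rewrite ffunE; exact: tf.
split=> [A|f].
  rewrite -[A]image_id -bigcup_imset1 preimage_bigcup.
  apply: fin_bigcup_measurable => [|f _]; first exact: finite_finset.
  by rewrite Y1; apply: fin_bigcap_measurable => // i _; exact: mX.
rewrite Y1 iX; under eq_bigr do rewrite uX.
by rewrite prodEFin prodr_const card_ffun natrX exprVn.
Qed.

End uniform_expectation.

(** * The error caused by colliding items *)

Definition noise (R : realType) (n B : nat) (u : hashfun n B) (i : 'I_n) : R :=
  \sum_(j | j != i) (u j == u i)%:R * zipf R j.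

Section noise.
Context {R : realType}.

Lemma zipf_ge0 (n : nat) (j : 'I_n) : 0 <= zipf R j.
Proof. by rewrite invr_ge0 ler0n. Qed.

Lemma noise_ge0 (n B : nat) (u : hashfun n B) (i : 'I_n) : 0 <= noise R u i.
Proof. by apply: sumr_ge0 => j _; rewrite mulr_ge0 ?ler0n ?zipf_ge0. Qed.

Lemma bucketE (n B : nat) (u : hashfun n B) (i : 'I_n) :
  bucket R u i = zipf R i + noise R u i.
Proof. by rewrite /bucket (bigD1 i) //= eqxx mul1r. Qed.

Lemma count_min_sub_le (n B k : nat) (g : 'I_k -> hashfun n B) (i : 'I_n)
  (l : 'I_k) : count_min R g i - zipf R i <= noise R (g l) i.
Proof. by rewrite lerBlDl -bucketE count_min_le. Qed.

Lemma count_min_sub_attained (n B k : nat) (g : 'I_k -> hashfun n B)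
  (i : 'I_n) : (0 < k)%N ->
  exists l : 'I_k, count_min R g i - zipf R i = noise R (g l) i.
Proof.
move=> /(count_min_attained R g i)[l ->]; exists l.
by rewrite bucketE addrC addKr.
Qed.

(** * Lower bound through an exponential moment of the noise *)

Lemma bernoulli_inequality (a : R) (m : nat) :
  a <= 1 -> 1 - m%:R * a <= (1 - a) ^+ m.
Proof.
move=> a1; elim: m => [|m IH]; first by rewrite expr0 mul0r subr0.
rewrite exprS; apply: le_trans (ler_wpM2l _ IH); last by rewrite subr_ge0.
rewrite -[m.+1%:R]natr1.
have : 0 <= m%:R * a ^+ 2 by rewrite mulr_ge0 ?ler0n ?sqr_ge0.
lra.
Qed.

Lemma prod_shift_ratio (n : nat) (a : R) : 0 < a ->
  \prod_(j < n) ((j%:R + a) / (j.+1%:R + a)) = a / (n%:R + a).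
Proof.
move=> a0; elim: n => [|n IH].
  by rewrite big_ord0 add0r divff // gt_eqF.
rewrite big_ord_recr /= IH; have n0 : 0 < n%:R + a by rewrite ltr_wpDl ?ler0n.
by rewrite mulrA divfK // gt_eqF.
Qed.

(** Deleting the [i]-th factor of the telescoping product costs at most [9 / 8], since that factor
    is at least [8 / 9]. *)
Lemma prod_shift_ratio_neq (n : nat) (b : R) (i : 'I_n) : 1 <= b ->
  \prod_(j < n | j != i) ((j%:R + 8 * b) / (j.+1%:R + 8 * b)) <=
  9 * b / (n%:R + 8 * b).
Proof.
move=> b1; have b0 : 0 < 8 * b by lra.
have := prod_shift_ratio n b0; rewrite (bigD1 i) //=.
set p := _ / _; set q := \prod_(_ | _) _ => pq.
have q0 : 0 <= q.
  by apply: prodr_ge0 => j _; rewrite divr_ge0 ?addr_ge0 ?ler0n // ltW.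
have p89 : 8 / 9 <= p.
  have i0 : 0 <= i%:R :> R by rewrite ler0n.
  by rewrite /p ler_pdivlMr -[i.+1%:R]natr1; lra.
have : 8 / 9 * q <= p * q by rewrite ler_wpM2r.
rewrite pq; set r := (n%:R + _)^-1; lra.
Qed.

Lemma expRN_le (y : R) : 0 <= y -> expR (- y) <= (1 + y)^-1.
Proof.
move=> y0; rewrite expRN lef_pV2 ?expR_ge1Dx // posrE ?expR_gt0 //.
by rewrite ltr_pwDl.
Qed.

Lemma laplace_factor_le (b : R) (j : nat) : 1 <= b ->
  1 + b^-1 * (expR (- (8 * b * j.+1%:R^-1)) - 1) <=
  ((j%:R + 8 * b) / (j.+1%:R + 8 * b)) ^+ 8.
Proof.
move=> b1; have b0 : 0 < b by lra.
have j0 : 0 <= j%:R :> R by rewrite ler0n.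
have a0 : 0 < j.+1%:R + 8 * b :> R by rewrite -[j.+1%:R]natr1; lra.
have -> : (j%:R + 8 * b) / (j.+1%:R + 8 * b) = 1 - (j.+1%:R + 8 * b)^-1.
  by rewrite -[j.+1%:R]natr1 in a0 *; field; rewrite gt_eqF.
apply: le_trans (bernoulli_inequality _ _); last first.
  by rewrite invf_le1 // -[j.+1%:R]natr1; lra.
have y0 : 0 <= 8 * b * j.+1%:R^-1 by rewrite mulr_ge0 ?invr_ge0 ?ler0n //; lra.
(* With [(1 + y)^-1] in place of the exponential, the scale [8 * b] gives exactly the Bernoulli
   bound for exponent [8]. *)
have -> : 1 - 8 * (j.+1%:R + 8 * b)^-1 =
    1 + b^-1 * ((1 + 8 * b * j.+1%:R^-1)^-1 - 1).
  rewrite -[j.+1%:R]natr1 in a0 *; field.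
  by rewrite !gt_eqF //; lra.
by rewrite lerD2l ler_wpM2l ?invr_ge0 ?(ltW b0) // lerD2r expRN_le.
Qed.

Lemma avg_laplace_noise (n B : nat) (i : 'I_n) : (0 < B)%N ->
  avg (fun u : hashfun n B => expR (- (8 * B%:R * noise R u i))) <=
  (9 * B%:R / (n%:R + 8 * B%:R)) ^+ 8.
Proof.
move=> B0; have B1 : 1 <= B%:R :> R by rewrite ler1n.
pose F (j : 'I_n) (c : bool) := expR (- (8 * B%:R * (c%:R * zipf R j))).
rewrite (@eq_avg _ _ _ (fun u : hashfun n B =>
    \prod_(j | j != i) F j (u j == u i))); last first.
  by move=> u; rewrite mulr_sumr -sumrN expR_sum.
rewrite avg_collisions card_ord // /F.
apply: (@le_trans _ _ (\prod_(j < n | j != i)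
    ((j%:R + 8 * B%:R) / (j.+1%:R + 8 * B%:R)) ^+ 8)).
  apply: ler_prod => j ji; rewrite mul0r mulr0 oppr0 expR0 mul1r.
  rewrite laplace_factor_le // andbT.
  rewrite mulrBr mulr1 addrCA addr_ge0 ?mulr_ge0 ?expR_ge0 ?invr_ge0 ?ler0n //.
  by rewrite subr_ge0 invf_le1 // (lt_le_trans ltr01).
rewrite prodrXl lerXn2r ?nnegrE ?prod_shift_ratio_neq //.
by apply: prodr_ge0 => j _; rewrite divr_ge0 // addr_ge0 ?mulr_ge0 ?ler0n.
Qed.

(** The eighth root lies below its tangent at [1]; this makes the Chernoff factor linear in [x]. *)
Lemma expR_eighth_ln_le (x : R) : 1 <= x -> expR (ln x / 8) <= (x + 7) / 8.
Proof.
move=> x1; rewrite -(@ler_pXn2r _ 8%N) ?nnegrE ?expR_ge0 //; last by lra.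
rewrite -expRM_natl mulrC divfK // lnK ?posrE; last by lra.
have /(@bernoulli_inequality _ 8%N) : (1 - x) / 8 <= 1 by lra.
rewrite (_ : 1 - (1 - x) / 8 = (x + 7) / 8); last by field.
by apply: le_trans; lra.
Qed.

(* Substituting [x = 2 + 10 * y], it is enough to compare [(1 + y) ^+ 8] with its
   terms of degree at most [2]; the claim is tight up to a few percent at
   [x = 2]. *)
Lemma power_bound (x : R) : 2 <= x ->
  x * ((x + 7) / 8) * (9 / (x + 8)) ^+ 8 <= 99 / 100.
Proof.
move=> x2; pose y := (x - 2) / 10.
have y0 : 0 <= y by rewrite /y; lra.
have -> : 9 / (x + 8) = 9 / 10 / (1 + y) by rewrite /y; field; lra.
have -> : x = 2 + 10 * y by rewrite /y; lra.
have hb : (1 + y) ^+ 8 >= 1 + 8 * y + 28 * y ^+ 2.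
  have h4 : (1 + y) ^+ 4 >= 1 + 4 * y + 6 * y ^+ 2.
    rewrite -subr_ge0 [leRHS](_ : _ = y ^+ 3 * (4 + y)); last by ring.
    by apply: mulr_ge0; [exact: exprn_ge0|lra].
  have -> : (1 + y) ^+ 8 = ((1 + y) ^+ 4) ^+ 2 by rewrite -exprM.
  apply: (@le_trans _ _ ((1 + 4 * y + 6 * y ^+ 2) ^+ 2)).
    rewrite -subr_ge0.
    rewrite [leRHS](_ : _ = y ^+ 3 * (48 + 36 * y)); last by ring.
    by apply: mulr_ge0; [exact: exprn_ge0|lra].
  have y2 : 0 <= y ^+ 2 by exact: sqr_ge0.
  by rewrite lerXn2r // nnegrE; lra.
(* At [y = 0] this leaves [9 / 4 * (7 / 16) = 63 / 64], still below [99 / 100]. *)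
have h9 : (9 / 10) ^+ 8 <= 7 / 16 :> R.
  have -> : (9 / 10) ^+ 8 = (((9 / 10) ^+ 2) ^+ 2) ^+ 2 :> R by rewrite -!exprM.
  have -> : (9 / 10) ^+ 2 = 81 / 100 :> R by field.
  have h : (81 / 100) ^+ 2 <= 33 / 50 :> R by lra.
  apply: (@le_trans _ _ ((33 / 50) ^+ 2)); last by lra.
  apply: lerXn2r => //; rewrite nnegrE; first exact: sqr_ge0.
  by lra.
rewrite expr_div_n [leLHS]mulrA ler_pdivrMr; last by rewrite exprn_gt0 //; lra.
have y2 : 0 <= y ^+ 2 by rewrite sqr_ge0.
apply: (@le_trans _ _ ((2 + 10 * y) * ((2 + 10 * y + 7) / 8) * (7 / 16))).
  by apply: ler_wpM2l h9; apply: mulr_ge0; lra.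
lra.
Qed.

(* If the error [B%:R * (count_min - zipf)] is below [t], then some summand is
   at least [1]: a union bound and Chernoff's inequality in one pointwise
   estimate. *)
Lemma threshold_le (n B k : nat) (g : 'I_k -> hashfun n B) (i : 'I_n) (t : R) :
  (0 < k)%N -> 0 <= t ->
  t <= B%:R * (count_min R g i - zipf R i) +
    t * \sum_l expR (8 * t) * expR (- (8 * B%:R * noise R (g l) i)).
Proof.
move=> k0 t0; have [l ->] := count_min_sub_attained g i k0.
have Bn0 : 0 <= B%:R * noise R (g l) i by rewrite mulr_ge0 ?ler0n ?noise_ge0.
have e0 (a b : R) : 0 <= expR a * expR b by rewrite mulr_ge0 ?expR_ge0.
have [tle|tgt] := leP t (B%:R * noise R (g l) i).
  by rewrite ler_wpDr // mulr_ge0 // sumr_ge0.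
rewrite ler_wpDl // ler_peMr // (bigD1 l) //= ler_wpDr ?sumr_ge0 //.
by rewrite -expRD -[leLHS]expR0 ler_expR; lra.
Qed.

Lemma avg_count_min_ge (n B k : nat) (i : 'I_n) :
  (0 < B)%N -> (2 <= k)%N -> B%:R <= n%:R / k%:R :> R ->
  6400^-1 * (ln (n%:R / B%:R) / B%:R) <=
  avg (fun g : {ffun 'I_k -> hashfun n B} => count_min R g i - zipf R i).
Proof.
move=> B0 k2 Bn; set E := avg _; set x : R := n%:R / B%:R.
have BR : 0 < B%:R :> R by rewrite ltr0n.
have kR : 2 <= k%:R :> R by rewrite ler_nat.
have kx : k%:R <= x.
  by rewrite /x ler_pdivlMr // mulrC -ler_pdivlMr //; lra.
have x2 : 2 <= x by lra.
have hash0 : (0 < #|{: hashfun n B}|)%N.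
  by rewrite card_ffun !card_ord expn_gt0 B0.
have hashk0 : (0 < #|{: {ffun 'I_k -> hashfun n B}}|)%N.
  by rewrite card_ffun expn_gt0 hash0.
(* Then [expR (8 * t)] is the eighth root of [x], and the union bound over [k <= x] functions is
   what [power_bound] controls. *)
set t := ln x / 64.
have t0 : 0 <= t by rewrite divr_ge0 // ln_ge0 //; lra.
have : t <= B%:R * E + t * (99 / 100).
  rewrite -[leLHS](avg_cst t hashk0).
  apply: le_trans (le_avg _) _.
    by move=> g; exact: (threshold_le g i (ltnW k2) t0).
  rewrite avgD !avgZ lerD2l ler_wpM2l // avg_sum.
  under eq_bigr => l _.
    rewrite avgZ.
    rewrite (avg_coord l (fun u => expR (- (8 * B%:R * noise R u i)))) //.
    over.
  rewrite sumr_const card_ord -[_ *+ _]mulr_natl mulrA.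
  apply: le_trans (power_bound x2).
  have -> : 9 / (x + 8) = 9 * B%:R / (n%:R + 8 * B%:R).
    rewrite /x; field; rewrite !gt_eqF //= ltr_wpDl ?ler0n //; lra.
  apply: ler_pM; rewrite ?mulr_ge0 ?expR_ge0 ?ler0n ?avg_laplace_noise //.
    by apply: sumr_ge0 => u _; exact: expR_ge0.
  apply: ler_pM; rewrite ?expR_ge0 ?ler0n //.
  rewrite (_ : 8 * t = ln x / 8); last by rewrite /t; field.
  by apply: expR_eighth_ln_le; lra.
(* What remains is [t / 100 = ln x / 6400], at most [B%:R * E]. *)
move=> tE; rewrite mulrA ler_pdivrMr //; rewrite /t in tE; lra.
Qed.

(** * Upper bound from two hash functions *)

(* The heavy items are the [B] most frequent ones; the mass of those that
   collide with [i] is at most the square of the following sum. *)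
Definition heavy_root (n B : nat) (i : 'I_n) (u : hashfun n B) : R :=
  \sum_(j | (j != i) && (j < B)%N) (u j == u i)%:R * Num.sqrt (zipf R j).

Definition light (n B : nat) (i : 'I_n) (u : hashfun n B) : R :=
  \sum_(j | (j != i) && (B <= j)%N) (u j == u i)%:R * zipf R j.

Lemma sum_sqr_le (I : finType) (P : pred I) (a : I -> R) :
  (forall j, 0 <= a j) ->
  \sum_(j | P j) a j ^+ 2 <= (\sum_(j | P j) a j) ^+ 2.
Proof.
move=> a0; rewrite [leRHS]expr2 mulr_suml; apply: ler_sum => j Pj.
by rewrite expr2 ler_wpM2l // (bigD1 j) //= lerDl sumr_ge0.
Qed.

Lemma heavy_root_ge0 (n B : nat) (i : 'I_n) (u : hashfun n B) :
  0 <= heavy_root i u.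
Proof. by apply: sumr_ge0 => j _; rewrite mulr_ge0 ?ler0n ?sqrtr_ge0. Qed.

Lemma light_ge0 (n B : nat) (i : 'I_n) (u : hashfun n B) : 0 <= light i u.
Proof. by apply: sumr_ge0 => j _; rewrite mulr_ge0 ?ler0n ?zipf_ge0. Qed.

(** An indicator equals its square, so the heavy mass is the sum of the squared terms of
    [heavy_root]. *)
Lemma noise_le (n B : nat) (i : 'I_n) (u : hashfun n B) :
  noise R u i <= heavy_root i u ^+ 2 + light i u.
Proof.
rewrite /noise (bigID (fun j : 'I_n => (j < B)%N)) /=; apply: lerD.
  apply: le_trans (sum_sqr_le _ _); last first.
    by move=> j; rewrite mulr_ge0 ?ler0n ?sqrtr_ge0.
  apply: ler_sum => j _; rewrite exprMn sqr_sqrtr ?zipf_ge0 //.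
  by case: (u j == u i); rewrite ?expr1n ?expr0n.
by rewrite /light; under eq_bigl do rewrite -leqNgt.
Qed.

(** The smaller of [w ^ 2] and [v ^ 2] is at most [w * v], whose average factors when [l != m].
    Averaging one heavy mass alone would bring in the harmonic sum up to [B]. *)
Lemma count_min_sub_le_pair (n B k : nat) (g : 'I_k -> hashfun n B)
    (i : 'I_n) (l m : 'I_k) :
  count_min R g i - zipf R i <=
  heavy_root i (g l) * heavy_root i (g m) + light i (g l) + light i (g m).
Proof.
have hl := le_trans (count_min_sub_le g i l) (noise_le i (g l)).
have hm := le_trans (count_min_sub_le g i m) (noise_le i (g m)).
have := heavy_root_ge0 i (g l); have := heavy_root_ge0 i (g m).
have := light_ge0 i (g l); have := light_ge0 i (g m).
set c := _ - _ in hl hm *; set w := heavy_root _ _ in hl *.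
set v := heavy_root _ _ in hm * => Cm Cl v0 w0.
have [wv|/ltW vw] := leP w v.
  have : w * w <= w * v by rewrite ler_wpM2l.
  by lra.
have : v * v <= w * v by rewrite ler_wpM2r.
by lra.
Qed.

Lemma avg_collision_sum (n B : nat) (i : 'I_n) (P : pred 'I_n) (a : 'I_n -> R) :
  (0 < B)%N -> (forall j, 0 <= a j) ->
  avg (fun u : hashfun n B =>
    \sum_(j | (j != i) && P j) (u j == u i)%:R * a j) <=
  B%:R^-1 * \sum_(j | P j) a j.
Proof.
move=> B0 a0; rewrite avg_sum mulr_sumr.
apply: (@le_trans _ _ (\sum_(j | (j != i) && P j) B%:R^-1 * a j)).
  apply: ler_sum => j /andP[ji _].
  rewrite (@eq_avg _ _ _ (fun u : hashfun n B => a j * (u j == u i)%:R)).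
    by rewrite avgZ avg_collision ?card_ord // mulrC.
  by move=> u; rewrite mulrC.
rewrite [leRHS](bigID (fun j => j != i)) /=.
under eq_bigl do rewrite andbC.
by rewrite lerDl sumr_ge0 // => j _; rewrite mulr_ge0 ?invr_ge0 ?ler0n.
Qed.

Lemma sum_inv_sqrt_le (m : nat) :
  \sum_(0 <= j < m) Num.sqrt (j.+1%:R^-1) <= 2 * Num.sqrt m%:R :> R.
Proof.
elim: m => [|m IH]; first by rewrite big_geq // sqrtr0 mulr0.
rewrite big_nat_recr //=; apply: le_trans (lerD IH (lexx _)) _.
rewrite sqrtrV ?ler0n // -lerBrDl -mulrBr.
have a0 : 0 < Num.sqrt (m.+1%:R : R) by rewrite sqrtr_gt0 ltr0n.
have a2 : Num.sqrt (m.+1%:R : R) ^+ 2 = m%:R + 1.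
  by rewrite sqr_sqrtr ?ler0n // natr1.
have b2 : Num.sqrt (m%:R : R) ^+ 2 = m%:R by rewrite sqr_sqrtr ?ler0n.
move: a0 a2 b2; set a := Num.sqrt _; set b := Num.sqrt _ => a0 a2 b2.
rewrite -[leLHS]mul1r ler_pdivrMr //.
(* As [a ^ 2 - b ^ 2 = 1], the goal [1 <= 2 * (a - b) * a] is [0 <= (a - b) ^ 2]. *)
have := sqr_ge0 (a - b); rewrite sqrrB a2 b2; lra.
Qed.

(** By induction on [n]: the new term [1 / (n + 1)] is at most [- ln (1 - 1 / (n + 1))], the
    increment of the logarithm. *)
Lemma sum_inv_le_ln (B n : nat) : (0 < B)%N -> (B <= n)%N ->
  \sum_(B <= j < n) j.+1%:R^-1 <= ln (n%:R / B%:R) :> R.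
Proof.
move=> B0; elim: n => [|n IH]; first by rewrite leqNgt B0.
have BR : 0 < B%:R :> R by rewrite ltr0n.
rewrite leq_eqVlt => /predU1P[->|].
  by rewrite big_geq // divff ?ln1 ?pnatr_eq0.
rewrite ltnS => Bn; rewrite big_nat_recr //=.
apply: le_trans (lerD (IH Bn) (lexx _)) _.
have nR : 0 < n%:R :> R by rewrite ltr0n (leq_trans B0).
have n1R : 0 < n.+1%:R :> R by rewrite ltr0n.
rewrite !ln_div ?posrE // -lerBrDl.
have -> : ln n.+1%:R - ln B%:R - (ln n%:R - ln B%:R) =
    - ln (n%:R / n.+1%:R) :> R.
  by rewrite ln_div ?posrE //; lra.
have -> : n%:R / n.+1%:R = 1 + - n.+1%:R^-1 :> R.
  by rewrite -[n.+1%:R]natr1 in n1R *; field; rewrite gt_eqF.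
rewrite lerNr; apply: le_ln1Dx.
by rewrite ltrN2 invf_lt1 // ltr1n ltnS -(ltr0n R).
Qed.

Lemma avg_heavy_root_le (n B : nat) (i : 'I_n) : (0 < B)%N -> (B <= n)%N ->
  avg (@heavy_root n B i) <= 2 / Num.sqrt B%:R.
Proof.
move=> B0 Bn; have BR : 0 < B%:R :> R by rewrite ltr0n.
apply: le_trans (@avg_collision_sum n B i (fun j => (j < B)%N)
  (fun j => Num.sqrt (zipf R j)) B0 (fun=> sqrtr_ge0 _)) _.
rewrite -(big_ord_widen n (fun j => Num.sqrt (j.+1%:R^-1)) Bn) /=.
rewrite -(big_mkord xpredT (fun j => Num.sqrt (j.+1%:R^-1))).
rewrite mulrC ler_pdivrMr // -{2}(sqr_sqrtr (ltW BR)) expr2 mulrA divfK.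
  exact: sum_inv_sqrt_le.
by rewrite gt_eqF // sqrtr_gt0.
Qed.

Lemma avg_light_le (n B : nat) (i : 'I_n) : (0 < B)%N -> (B <= n)%N ->
  avg (@light n B i) <= ln (n%:R / B%:R) / B%:R.
Proof.
move=> B0 Bn; apply: le_trans (@avg_collision_sum n B i
  (fun j => (B <= j)%N) (@zipf R n) B0 (@zipf_ge0 n)) _.
rewrite mulrC ler_wpM2r ?invr_ge0 ?ler0n //.
by rewrite -(big_geq_mkord _ _ xpredT (fun j => j.+1%:R^-1)) sum_inv_le_ln.
Qed.

Lemma avg_count_min_le (n B k : nat) (i : 'I_n) :
  (0 < B)%N -> (2 <= k)%N -> B%:R <= n%:R / k%:R :> R ->
  avg (fun g : {ffun 'I_k -> hashfun n B} => count_min R g i - zipf R i) <=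
  10 * (ln (n%:R / B%:R) / B%:R).
Proof.
move=> B0 k2 Bn; set x : R := n%:R / B%:R.
have BR : 0 < B%:R :> R by rewrite ltr0n.
have kR : 2 <= k%:R :> R by rewrite ler_nat.
have x2 : 2 <= x.
  apply: le_trans kR _.
  by rewrite /x ler_pdivlMr // mulrC -ler_pdivlMr // ltr0n (ltn_trans _ k2).
have leBn : (B <= n)%N.
  rewrite -(ler_nat R); have : 2 * B%:R <= n%:R :> R by rewrite -ler_pdivlMr.
  lra.
have hash0 : (0 < #|{: hashfun n B}|)%N.
  by rewrite card_ffun !card_ord expn_gt0 B0.
pose l := Ordinal (ltnW k2); pose m := Ordinal k2.
apply: le_trans (le_avg _) _.
  by move=> g; exact: (count_min_sub_le_pair g i l m).
rewrite !avgD (avg_coord l (@light n B i)) // (avg_coord m (@light n B i)) //.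
rewrite (avg_coord2 (@heavy_root n B i) (@heavy_root n B i)) //.
(* From [ln x >= 1 - 1 / x]. It absorbs the heavy part [4 / B] into [8 * ln x / B]; the two light
   parts add [2 * ln x / B], hence the constant [10]. *)
have lnx : 1 / 2 <= ln x.
  have /le_ln1Dx : -1 < x^-1 - 1 by rewrite ltrBrDl subrr invr_gt0; lra.
  rewrite addrC subrK lnV ?posrE; last by lra.
  have : x^-1 <= 2^-1 by rewrite lef_pV2 ?posrE; lra.
  lra.
have C := avg_light_le i B0 leBn; rewrite -/x in C.
have W := avg_heavy_root_le i B0 leBn.
have W0 : 0 <= avg (@heavy_root n B i) by apply: avg_ge0; exact: heavy_root_ge0.
have WW : avg (@heavy_root n B i) * avg (@heavy_root n B i) <= 4 / B%:R.
  apply: le_trans (ler_pM W0 W0 W W) _.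
  rewrite -expr2 expr_div_n sqr_sqrtr ?(ltW BR) //.
  by rewrite ler_wpM2r ?invr_ge0 ?ler0n // expr2 -natrM.
have : 4 / B%:R <= 8 * (ln x / B%:R).
  by rewrite mulrA ler_wpM2r ?invr_ge0 ?ler0n //; lra.
lra.
Qed.

End noise.

(** * Transfer of both bounds to arbitrary independent uniform hash functions *)

Theorem theorem3p1 (R : realType) :
  exists c C : R, [/\ 0 < c, 0 < C &
    forall (n B k : nat), (0 < B)%N -> (2 <= k)%N ->
      B%:R <= n%:R / k%:R :> R ->
    forall (d : measure_display) (T : measurableType d) (P : probability T R)
      (h : 'I_k -> T -> hashfun n B),
      (forall l, finite_random_element (h l)) ->
      (forall l, uniform_element P (h l)) ->
      mutually_independent P h ->
    forall i : 'I_n,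
      ((c * (ln (n%:R / B%:R) / B%:R))%:E
         <= 'E_P[fun t => `|count_min R (fun l => h l t) i - zipf R i|%R])%E /\
      ('E_P[fun t => `|count_min R (fun l => h l t) i - zipf R i|%R]
         <= (C * (ln (n%:R / B%:R) / B%:R))%:E)%E].
Proof.
exists 6400^-1, 10; split; rewrite ?invr_gt0 ?ltr0n //.
move=> n B k B0 k2 Bn d T P h mh uh ih i.
have [mH uH] := uniform_joint mh uh ih.
pose dev (g : {ffun 'I_k -> hashfun n B}) := count_min R g i - zipf R i.
have dev0 g : 0 <= dev g.
  have [l] := count_min_sub_attained (R := R) g i (ltnW k2).
  by rewrite /dev => ->; exact: noise_ge0.
have -> : (fun t => `|count_min R (fun l => h l t) i - zipf R i|) =
    (fun t => dev [ffun l => h l t]).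
  apply/funext => t; rewrite -[RHS]ger0_norm // /dev.
  congr (`|count_min R _ i - _|).
  by apply/funext => l; rewrite ffunE.
rewrite (expectation_uniform mH uH dev0) !lee_fin.
by split; [exact: avg_count_min_ge|exact: avg_count_min_le].
Qed.
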